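(* Let $\mathcal{A}$ be a zero-nonzero pattern of order $n$, and suppose $A\in\mathcal{A}$ is a nilpotent matrix that allows a full-rank Jacobian. Let $u\neq v$ be vertices (indices in $\{1,\dots,n\}$) with $\det A(u,v)\neq 0$. If $\mathcal{B}$ is a $\circledast$-extension of $\mathcal{A}$ at $(u,v)$, then every superpattern of $\mathcal{B}$ is spectrally arbitrary.
   Context: A zero-nonzero pattern is a square matrix with entries in $\{0,*,\circledast\}$. A real matrix $A=[a_{ij}]$ has pattern $\mathcal{A}$ ($A\in\mathcal{A}$) if $a_{ij}=0$ whenever $\mathcal{A}_{ij}=0$ and $a_{ij}\neq0$ whenever $\mathcal{A}_{ij}=*$ (no restriction when $\mathcal{A}_{ij}=\circledast$). The digraph $D(\mathcal{A})$ has vertices $\{1,\dots,n\}$ and an arc $(i,j)$, labeled $\mathcal{A}_{ij}$, exactly when $\mathcal{A}_{ij}\neq 0$. $A(u,v)$ denotes the $(n-1)\times(n-1)$ matrix obtained from $A$ by deleting row $u$ and column $v$. $A$ allows a full-rank Jacobian: if $A$ has $m$ nonzero entries in positions $(i_1,j_1),\dots,(i_m,j_m)$, let $X$ be obtained from $A$ by replacing the entry at $(i_k,j_k)$ by an indeterminate $x_k$, write $\det(zI-X)=z^n+f_1z^{n-1}+\cdots+f_n$, and let $J_{ij}=\partial f_i/\partial x_j$; $A$ allows a full-rank Jacobian if $J$ evaluated at the entries of $A$ has rank $n$. A pattern of order $N$ is spectrally arbitrary if for every monic real polynomial $p$ of degree $N$ some real matrix in the pattern has characteristic polynomial $p$.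 A pattern $\mathcal{C}$ is a superpattern of $\mathcal{B}$ if $\mathcal{B}_{ij}\neq0$ implies $\mathcal{C}_{ij}=\mathcal{B}_{ij}$. $\circledast$-extension: for distinct vertices $u,v$ of a digraph $G$ (not necessarily with $(u,v)$ an arc), a digraph $H$ is a $\circledast$-extension of $G$ at $(u,v)$ if it is obtained from $G$ by adding a new vertex $w$ and the two arcs $(u,w)$ and $(w,v)$, with at least one of these new arcs labeled $\circledast$ and the other labeled $\circledast$ or $*$. A pattern $\mathcal{B}$ of order $n+1$ is a $\circledast$-extension of $\mathcal{A}$ at $(u,v)$ if $D(\mathcal{B})$ (with labels) is a $\circledast$-extension of $D(\mathcal{A})$ at $(u,v)$; i.e., $\mathcal{B}$ agrees with $\mathcal{A}$ on the original $n\times n$ block, its new row and column $w$ are zero except for the entries $(u,w)$ and $(w,v)$. *)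

(* Defs.v *)
From HB Require Import structures.
From mathcomp Require Import all_boot all_order all_algebra.
From mathcomp Require Import mpoly.

Set Implicit Arguments.
Unset Strict Implicit.
Unset Printing Implicit Defensive.

Import GRing.Theory.
Local Open Scope ring_scope.

(* [Free] is the symbol \circledast. *)
Inductive symbol : Type := Zero | Star | Free.

Definition pattern (n : nat) : Type := 'M[symbol]_n.

Definition has_pattern (F : fieldType) (n : nat) (P : pattern n)
    (A : 'M[F]_n) : Prop :=
  forall i j, match P i j with
              | Zero => A i j = 0
              | Star => A i j <> 0
              | Free => True
              end.

Definition nilpotent_mx (F : fieldType) (n : nat) (A : 'M[F]_n) : Prop :=
  exists k : nat, A ^+ k = 0.

Definition spectrally_arbitrary (F : fieldType) (n : nat) (P : pattern n)
    : Prop :=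
  forall p : {poly F}, p \is monic -> size p = n.+1 ->
    exists2 M : 'M[F]_n, has_pattern P M & char_poly M = p.

Definition superpattern (n : nat) (B C : pattern n) : Prop :=
  forall i j, B i j <> Zero -> C i j = B i j.

Section Jacobian.
Variables (F : fieldType) (n : nat) (A : 'M[F]_n).

Definition nz_support : {set 'I_n * 'I_n} := [set ij | A ij.1 ij.2 != 0].

Definition nz_pos (k : 'I_#|nz_support|) : 'I_n * 'I_n := enum_val k.

Definition nz_entry (k : 'I_#|nz_support|) : F := A (nz_pos k).1 (nz_pos k).2.

Definition indeterminate_mx : 'M[{mpoly F[#|nz_support|]}]_n :=
  \matrix_(i, j)
    if [pick k | nz_pos k == (i, j)] is Some k then 'X_k else (A i j)%:MP.

(* Row [i] (counted from 0) belongs to f_(i+1), the coefficient of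
   z^(n-(i+1)) in det(zI - X). *)
Definition char_jacobian :
    'M[{mpoly F[#|nz_support|]}]_(n, #|nz_support|) :=
  \matrix_(i, k) mderiv k ((char_poly indeterminate_mx)`_(n - i.+1)).

Definition full_rank_jacobian : Prop :=
  \rank (map_mx (meval nz_entry) char_jacobian) = n.

End Jacobian.

(* The new vertex w is [ord_max : 'I_n.+1]; the old vertex [i : 'I_n] becomes
   [lift ord_max i], which has the same value as [i]. *)
Definition circledast_extension (n : nat) (A : pattern n) (u v : 'I_n)
    (B : pattern n.+1) : Prop :=
  let w : 'I_n.+1 := ord_max in
  let old (i : 'I_n) : 'I_n.+1 := lift ord_max i in
  [/\ forall i j, B (old i) (old j) = A i j,
      B w w = Zero,
      forall i, i <> u -> B (old i) w = Zero,
      forall j, j <> v -> B w (old j) = Zero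
    & [/\ B (old u) w <> Zero, B w (old v) <> Zero
        & B (old u) w = Free \/ B w (old v) = Free]].

(* Main.v *)
Require Import Defs.
From HB Require Import structures.
From mathcomp Require Import all_boot all_order all_algebra.
From mathcomp Require Import reals zify ring lra.
From mathcomp Require mpoly.

(** The differential of the characteristic polynomial at [A] in direction [H] is
    - \sum_(i, j) H_ij cofactor_ij(zI - A), so the full-rank hypothesis says that
    these differentials, for [H] supported on the nonzero entries of [A], fill the
    polynomials of degree < n.  Let B be the extension of [A] in which a free new
    entry is 0 and the other one is 1.  Then B is nilpotent; directions in the old
    block contribute 'X times the old differentials, while the free new entry
    contributes a polynomial with constant coefficient +- det A(u,v) <> 0.  Hence the
    differential at B fills the polynomials of degree < n+1 using only entries at
    which the pattern does not prescribe 0.  By a contraction argument every monic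
    polynomial close to 'X^(n+1) is the characteristic polynomial of a matrix close
    to B, even after adding a small nonzero e at the extra positions of the
    superpattern; rescaling the matrix reaches all monic polynomials. *)

Set Implicit Arguments.
Unset Strict Implicit.
Unset Printing Implicit Defensive.

Import Order.TTheory GRing.Theory Num.Theory.
Local Open Scope ring_scope.

(** * Differential of the characteristic polynomial *)

(** Derivations along a ring morphism cover both uses below: the coefficient of t over evaluation at
    t = 0, and a partial derivative followed by evaluation at a point. *)
Definition point_derivation (S T : comNzRingType) (ev : S -> T) (D : S -> T) :=
  forall p q, D (p * q) = D p * ev q + ev p * D q.

Section Derivation.
Variables (S T : comNzRingType) (ev : {rmorphism S -> T}) (D : {additive S -> T}).
Hypothesis derD : point_derivation ev D.

Lemma point_derivation1 : D 1 = 0.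
Proof.
have := derD 1 1; rewrite !mulr1 rmorph1 mulr1 mul1r => /eqP.
by rewrite -subr_eq0 opprD addNKr oppr_eq0 => /eqP.
Qed.

Lemma point_derivation_prod (I : eqType) (s : seq I) (F : I -> S) : uniq s ->
  D (\prod_(i <- s) F i) =
  \sum_(k <- s) \prod_(i <- s) (if i == k then D (F i) else ev (F i)).
Proof.
elim: s => [|a s IH] /=; first by rewrite !big_nil point_derivation1.
case/andP=> nas us; rewrite big_cons derD IH // big_cons big_cons eqxx.
rewrite rmorph_prod; congr (_ + _).
  congr (_ * _); apply: eq_big_seq => i si.
  by case: eqP => // ia; rewrite -ia si in nas.
rewrite mulr_sumr; apply: eq_big_seq => k sk; rewrite big_cons.
by case: eqP => // ak; rewrite ak sk in nas.
Qed.

Lemma point_derivation_sign (b : bool) x : D ((-1) ^+ b * x) = (-1) ^+ b * D x.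
Proof. by case: b; rewrite ?expr0 ?expr1 ?mulN1r ?raddfN ?mul1r. Qed.

(** Jacobi's formula: the Leibniz rule gives a sum over k of determinants in which only row k is
    differentiated, and each is expanded along that row. *)
Lemma point_derivation_det m (M : 'M[S]_m) :
  D (\det M) = \sum_i \sum_j D (M i j) * cofactor (map_mx ev M) i j.
Proof.
rewrite /determinant raddf_sum /=.
under eq_bigr do rewrite point_derivation_sign point_derivation_prod
  ?index_enum_uniq // mulr_sumr.
rewrite exchange_big /=; apply: eq_bigr => k _.
pose N := \matrix_(i, j) (if i == k then D (M i j) else ev (M i j)).
transitivity (\det N).
  by apply: eq_bigr => s _; congr (_ * _); apply: eq_bigr => i _; rewrite mxE.
rewrite (expand_det_row _ k); apply: eq_bigr => j _.
rewrite !mxE eqxx; congr (_ * (_ * \det _)).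
by apply/matrixP=> i l; rewrite !mxE [_ == k]eq_sym (negPf (neq_lift _ _)).
Qed.

Lemma point_derivation_map_poly :
  point_derivation (map_poly ev) (map_poly D).
Proof.
move=> p q; apply/polyP=> i.
rewrite coef_map coefD !coefM raddf_sum -big_split; apply: eq_bigr => j _.
by rewrite /= derD !coef_map.
Qed.
End Derivation.

(* The differential of the characteristic polynomial at [A] in direction [H]. *)
Definition char_poly_diff (T : comNzRingType) m (A H : 'M[T]_m) : {poly T} :=
  - \sum_i \sum_j (H i j)%:P * cofactor (char_poly_mx A) i j.

(** Jacobi's formula for [D] acting coefficientwise. Since [D] kills 1, it kills the 'X on the
    diagonal of zI - M, and only the negated derivatives of the entries of [M] survive. *)
Lemma point_derivation_char_poly (S T : comNzRingType)
    (ev : {rmorphism S -> T}) (D : {additive S -> T}) m (M : 'M[S]_m) :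
  point_derivation ev D ->
  map_poly D (char_poly M) = char_poly_diff (map_mx ev M) (map_mx D M).
Proof.
move=> derD; rewrite /char_poly.
rewrite (point_derivation_det (point_derivation_map_poly derD)).
rewrite map_char_poly_mx /char_poly_diff -sumrN; apply: eq_bigr => i _.
rewrite -sumrN; apply: eq_bigr => j _; rewrite -mulNr; congr (_ * _).
rewrite !mxE raddfB /= map_polyC /=; apply/polyP=> k.
rewrite coefB coefN coef_map coefMn coefX raddfMn /=.
case: (k == 1)%N; rewrite ?raddf0 ?(point_derivation1 derD) !mul0rn ?sub0r //.
Qed.

Section CharPolyDiff.
Variables (T : comNzRingType) (m : nat) (A : 'M[T]_m).

Lemma char_poly_diff_is_linear : linear (char_poly_diff A).
Proof.
move=> a H K; rewrite /char_poly_diff scalerN -opprD; congr (- _).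
rewrite scaler_sumr -big_split; apply: eq_bigr => i _.
rewrite scaler_sumr -big_split; apply: eq_bigr => j _ /=.
by rewrite !mxE polyCD polyCM mulrDl -mulrA mul_polyC.
Qed.
HB.instance Definition _ := GRing.isLinear.Build T 'M[T]_m {poly T} *:%R
  (char_poly_diff A) char_poly_diff_is_linear.
End CharPolyDiff.

Lemma point_derivation_coef1 (T : comNzRingType) :
  point_derivation (horner_eval (0 : T)) (coefp 1).
Proof.
move=> p q; rewrite /horner_eval /= !horner_coef0 coefM !big_ord_recl.
by rewrite big_ord0 addr0 addrC.
Qed.

(** The coefficient of t in the characteristic polynomial of A + tH. Identities for [char_poly] over
    polynomials in t thereby transfer to the differential. *)
Lemma char_poly_diff_coef1 (T : comNzRingType) m (A H : 'M[T]_m) :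
  char_poly_diff A H =
  map_poly (coefp 1) (char_poly (map_mx polyC A + 'X *: map_mx polyC H)).
Proof.
rewrite (point_derivation_char_poly _ (@point_derivation_coef1 T)).
congr char_poly_diff; apply/matrixP=> i j; rewrite !mxE.
  by rewrite /= /horner_eval hornerD hornerM hornerX !hornerC mul0r addr0.
by rewrite /= coefD coefC add0r coefXM coefC.
Qed.

(** The characteristic polynomial of A + tH is monic of degree m for all t, so its leading
    coefficient has no t-term. *)
Lemma size_char_poly_diff (T : comNzRingType) m (A H : 'M[T]_m) :
  (size (char_poly_diff A H) <= m)%N.
Proof.
apply/leq_sizeP=> i mi; rewrite char_poly_diff_coef1 coef_map.
set M := _ + _; have := size_char_poly M; have := char_poly_monic M.
rewrite monicE lead_coefE => /[swap] sM; rewrite sM => /= /eqP lM.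
move: mi; rewrite leq_eqVlt => /predU1P[<-|mi]; first by rewrite lM coef1.
have -> : (char_poly M)`_i = 0 by rewrite nth_default ?sM.
by rewrite /= coef0.
Qed.

(** If A^k = 0 then zI - A divides (zI)^k - A^k = z^k I. Taking determinants, [char_poly A] divides
    'X^(k * n), so it is a power of 'X, and its size fixes the exponent. *)
Lemma char_poly_nilpotent (F : fieldType) n (A : 'M[F]_n) :
  nilpotent_mx A -> char_poly A = 'X^n.
Proof.
case=> k Ak.
have [q Eq] : exists q, char_poly A * q = 'X^(k * n).
  pose Y : 'M[{poly F}]_n := 'X%:M; pose B := map_mx polyC A.
  exists (\det (\sum_(i < k) Y ^+ (k.-1 - i) * B ^+ i)).
  rewrite /char_poly -det_mulmx.
  have cYB : GRing.comm Y B by apply/esym; exact: scalar_mxC.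
  have XB i : B ^+ i = map_mx polyC (A ^+ i).
    elim: i => [|i IH]; first by rewrite !expr0 map_mx1.
    by rewrite !exprS -mulmxE map_mxM IH.
  have XY i : Y ^+ i = ('X^i)%:M.
    by elim: i => [|i IH]; rewrite ?expr0 // !exprS IH -mulmxE -scalar_mxM.
  have := subrXX_comm k cYB; rewrite XB XY Ak map_mx0 subr0 => /esym E.
  by rewrite -[_ *m _]/((Y - B) * _) E det_scalar exprM.
have : char_poly A %| ('X - 0%:P) ^+ (k * n) by rewrite subr0 -Eq dvdp_mulr.
case/dvdp_exp_XsubCP => l _ Hl.
have : char_poly A = 'X^l.
  apply/eqP; rewrite -eqp_monic ?char_poly_monic ?monicXn //. 
  by move: Hl; rewrite subr0.
move=> E; move/(congr1 (size \o (@polyseq _))): (E).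
by rewrite /= size_char_poly size_polyXn E => -[->].
Qed.

(** * Partial derivatives at a point and the Jacobian *)

Section DerivativeAtPoint.
Import mpoly.
Variables (R : comNzRingType) (m : nat) (x : 'I_m -> R) (k : 'I_m).

Definition mderiv_at : {mpoly R[m]} -> R := meval x \o mderiv k.
HB.instance Definition _ := GRing.Additive.copy mderiv_at (meval x \o mderiv k).

Lemma point_derivation_mderiv_at : point_derivation (meval x) mderiv_at.
Proof. by move=> p q; rewrite /mderiv_at /= mderivM mevalD !mevalM. Qed.

Lemma mderiv_atC c : mderiv_at c%:MP = 0.
Proof. by rewrite /mderiv_at /= mderivC meval0. Qed.

Lemma mderiv_atX j : mderiv_at 'X_j = (j == k)%:R.
Proof.
rewrite /mderiv_at /= mderivX mevalZ mnm1E; case: eqP => [->|_].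
  by rewrite mevalX big1 ?mulr1 // => l _; rewrite mnmBE subnn expr0.
by rewrite mul0r.
Qed.
End DerivativeAtPoint.

Section JacobianSpan.
Import mpoly.
Variables (F : fieldType) (n : nat) (A : 'M[F]_n).

Lemma meval_indeterminate_mx :
  map_mx (meval (nz_entry (A := A))) (indeterminate_mx A) = A.
Proof.
apply/matrixP=> i j; rewrite !mxE; case: pickP => [k /eqP kij|_].
  by rewrite mevalXU /nz_entry kij.
by rewrite mevalC.
Qed.

Lemma mderiv_at_indeterminate_mx k :
  map_mx (mderiv_at (nz_entry (A := A)) k) (indeterminate_mx A) =
  delta_mx (nz_pos k).1 (nz_pos k).2.
Proof.
apply/matrixP=> i j; rewrite !mxE.
have -> : (i == (nz_pos k).1) && (j == (nz_pos k).2) = (nz_pos k == (i, j)).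
  by case: (nz_pos k) => a b; rewrite xpair_eqE ![_ == i]eq_sym ![_ == j]eq_sym.
case: pickP => [k' k'ij|/(_ k) ->]; last by rewrite mderiv_atC.
rewrite mderiv_atX -(eqP k'ij) eq_sym; congr (nat_of_bool _)%:R.
exact/esym/(inj_eq (@enum_val_inj _ _)).
Qed.

Lemma char_jacobianE (i : 'I_n) k :
  map_mx (meval (nz_entry (A := A))) (char_jacobian A) i k =
  (char_poly_diff A (delta_mx (nz_pos k).1 (nz_pos k).2))`_(n - i.+1).
Proof.
have := point_derivation_char_poly (indeterminate_mx A)
  (point_derivation_mderiv_at (nz_entry (A := A)) k).
rewrite meval_indeterminate_mx mderiv_at_indeterminate_mx => <-.
by rewrite coef_map !mxE.
Qed.

(** The columns of the Jacobian are the differentials in the directions of the nonzero entries of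
    [A]; a right inverse of the Jacobian produces the required combination. *)
Lemma char_poly_diff_span : full_rank_jacobian A ->
  forall q : {poly F}, (size q <= n)%N ->
  exists2 H : 'M[F]_n, (forall i j, A i j = 0 -> H i j = 0) & char_poly_diff A H = q.
Proof.
rewrite /full_rank_jacobian; set J := map_mx _ _ => rJ q sq.
have /row_freeP[K JK] : row_free J by rewrite /row_free rJ.
(* Row i of the Jacobian belongs to the coefficient of index n - (i + 1), so the coefficients of [q]
   are listed in reverse. *)
pose c : 'cV[F]_n := \col_i q`_(n - i.+1).
pose y := K *m c.
exists (\sum_k y k 0 *: delta_mx (nz_pos k).1 (nz_pos k).2).
  move=> i j Aij; rewrite summxE big1 // => k _; rewrite !mxE.
  case: andP => [[/eqP Ei /eqP Ej]|_]; last by rewrite mulr0.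
  have := enum_valP k; rewrite inE -/(nz_pos k) -Ei -Ej Aij eqxx //.
apply/polyP=> l; have [ln|nl] := ltnP l n; last first.
  by rewrite !nth_default // (leq_trans _ nl) // size_char_poly_diff.
have li : (n - l.+1 < n)%N by rewrite ltn_subrL (leq_ltn_trans _ ln).
have El : l = (n - (Ordinal li).+1)%N by rewrite /= -subSn // subSS subKn // ltnW.
have : (J *m y) (Ordinal li) 0 = c (Ordinal li) 0 by rewrite mulmxA JK mul1mx.
rewrite !mxE -El => <-; rewrite linear_sum coef_sum; apply: eq_bigr => k _.
by rewrite linearZ coefZ char_jacobianE -El mulrC.
Qed.
End JacobianSpan.

(** * Extension by one vertex *)

(** The same shape serves for matrices over the field, for matrices over polynomials in t, and for
    directions of differentiation. *)
Definition ext_mx (S : nmodType) n (X : 'M[S]_n) (u v : 'I_n) (x y : S)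
    : 'M[S]_n.+1 :=
  \matrix_(i, j) match unlift ord_max i, unlift ord_max j with
                 | Some i', Some j' => X i' j'
                 | Some i', None => if i' == u then x else 0
                 | None, Some j' => if j' == v then y else 0
                 | None, None => 0
                 end.

Section ExtMx.
Variables (S : comNzRingType) (n : nat) (X : 'M[S]_n) (u v : 'I_n) (x y : S).
Let M := ext_mx X u v x y.

Lemma ext_mx_oo i j : M (lift ord_max i) (lift ord_max j) = X i j.
Proof. by rewrite mxE !liftK. Qed.
Lemma ext_mx_ow i : M (lift ord_max i) ord_max = if i == u then x else 0.
Proof. by rewrite mxE liftK unlift_none. Qed.
Lemma ext_mx_wo j : M ord_max (lift ord_max j) = if j == v then y else 0.
Proof. by rewrite mxE liftK unlift_none. Qed.
Lemma ext_mx_ww : M ord_max ord_max = 0.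
Proof. by rewrite mxE !unlift_none. Qed.

Lemma row'_col'_ext_mx : row' ord_max (col' ord_max M) = X.
Proof. by apply/matrixP=> i j; rewrite !mxE !liftK. Qed.

(** If x = 0 (resp. y = 0), the last column (resp. row) of zI - M has only its diagonal entry 'X
    left; expand along it. *)
Lemma char_poly_ext_mx : x = 0 \/ y = 0 -> char_poly M = 'X * char_poly X.
Proof.
have E : cofactor (char_poly_mx M) ord_max ord_max = char_poly X.
  rewrite /cofactor /= addnn -signr_odd odd_double mul1r; congr (\det _).
  rewrite -[in RHS]row'_col'_ext_mx; apply/matrixP=> i j.
  by rewrite !mxE (inj_eq (@lift_inj _ _)).
case=> xy0; rewrite /char_poly.
  rewrite (expand_det_col _ ord_max) (bigD1 ord_max) //= E big1 ?addr0.
    by rewrite !mxE eqxx !unlift_none subr0.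
  move=> i; case: (unliftP ord_max i) => [k -> _|->]; last by rewrite eqxx.
  rewrite !mxE liftK unlift_none eq_sym (negPf (neq_lift _ _)) xy0 if_same.
  by rewrite mulr0n subr0 mul0r.
rewrite (expand_det_row _ ord_max) (bigD1 ord_max) //= E big1 ?addr0.
  by rewrite !mxE eqxx !unlift_none subr0.
move=> i; case: (unliftP ord_max i) => [k -> _|->]; last by rewrite eqxx.
rewrite !mxE liftK unlift_none (negPf (neq_lift _ _)) xy0 if_same.
by rewrite mulr0n subr0 mul0r.
Qed.
End ExtMx.

(** Expansion along row w leaves y, then along column w leaves x. Only nonvanishing matters later,
    so the sign stays existential. *)
Lemma det_ext_mx (S : comNzRingType) n (X : 'M[S]_n) (u v : 'I_n) (x y : S) :
  exists b : nat, \det (ext_mx X u v x y) =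
    (-1) ^+ b * (x * y * \det (row' u (col' v X))).
Proof.
case: n X u v => [|n] X u v; first by case: u.
pose w : 'I_n.+2 := ord_max; set M := ext_mx X u v x y.
pose N := row' w (col' (lift w v) M).
exists ((w + lift w v) + (u + @ord_max n))%N.
(* Once column v is deleted, column w is still the last one. *)
have wE : lift (lift w v) ord_max = w.
  by apply: val_inj; rewrite /= /bump; have := ltn_ord v; lia.
have detN : \det N = x * ((-1) ^+ (u + @ord_max n) * \det (row' u (col' v X))).
  rewrite (expand_det_col _ ord_max) (bigD1 u) //= big1 ?addr0.
    rewrite [N _ _]mxE [col' _ _ _ _]mxE wE ext_mx_ow eqxx.
    congr (_ * (_ * \det _)); apply/matrixP=> i j.
    rewrite [LHS]mxE [LHS]mxE [LHS]mxE [LHS]mxE [RHS]mxE [RHS]mxE.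
    suff -> : lift (lift w v) (lift ord_max j) = lift w (lift v j).
      by rewrite ext_mx_oo.
    apply: val_inj; rewrite /= /bump.
    by have := ltn_ord v; have := ltn_ord j; lia.
  by move=> i /negPf iu; rewrite [N _ _]mxE [col' _ _ _ _]mxE wE ext_mx_ow iu mul0r.
rewrite (expand_det_row _ w) (bigD1 (lift w v)) //= big1 ?addr0.
  rewrite ext_mx_wo eqxx /cofactor -/N detN [in RHS]exprD; ring.
move=> j; case: (unliftP w j) => [k ->|-> _]; last by rewrite ext_mx_ww mul0r.
by rewrite (inj_eq (@lift_inj _ _)) ext_mx_wo => /negPf ->; rewrite mul0r.
Qed.

Lemma map_ext_mx (S T : nmodType) (f : {additive S -> T}) n (X : 'M[S]_n) u v x y :
  map_mx f (ext_mx X u v x y) = ext_mx (map_mx f X) u v (f x) (f y).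
Proof.
apply/matrixP=> i j; rewrite !mxE.
by case: (unlift _ i) => [i'|]; case: (unlift _ j) => [j'|];
  rewrite ?mxE ?raddf0 //; case: ifP => //; rewrite raddf0.
Qed.

Lemma scale_ext_mx (S : comNzRingType) n (X : 'M[S]_n) u v a x y :
  a *: ext_mx X u v x y = ext_mx (a *: X) u v (a * x) (a * y).
Proof.
apply/matrixP=> i j; rewrite !mxE.
by case: (unlift _ i) => [i'|]; case: (unlift _ j) => [j'|];
  rewrite ?mxE ?mulr0 //; case: ifP => //; rewrite mulr0.
Qed.

Lemma add_ext_mx (S : comNzRingType) n (X Y : 'M[S]_n) u v x y x' y' :
  ext_mx X u v x y + ext_mx Y u v x' y' = ext_mx (X + Y) u v (x + x') (y + y').
Proof.
apply/matrixP=> i j; rewrite !mxE.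
by case: (unlift _ i) => [i'|]; case: (unlift _ j) => [j'|];
  rewrite ?mxE ?addr0 //; case: ifP => //; rewrite addr0.
Qed.

Section ExtSpan.
Variables (F : fieldType) (n : nat) (A : 'M[F]_n) (u v : 'I_n) (x y : F).

(** Moving from the extension of [A] along that of [H] gives the extension of A + tH with the same x
    and y, to which [char_poly_ext_mx] applies over polynomials in t. *)
Lemma char_poly_diff_ext_mx (H : 'M[F]_n) : x = 0 \/ y = 0 ->
  char_poly_diff (ext_mx A u v x y) (ext_mx H u v 0 0) =
  'X * char_poly_diff A H.
Proof.
move=> xy0; rewrite !char_poly_diff_coef1 !map_ext_mx scale_ext_mx add_ext_mx.
rewrite !raddf0 mulr0 !addr0 char_poly_ext_mx; last first.
  by case: xy0 => ->; [left|right].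
apply/polyP=> i; rewrite coef_map !coefXM coef_map /=.
by case: (i == 0)%N; rewrite ?coef0.
Qed.

(** The direction (1 - x, 1 - y) moves just the new entry that is 0. The product of the new entries
    becomes t, so the determinant along this line is +- t det A(u,v). *)
Lemma char_poly_diff_ext_mx_coef0 :
  (x = 0 /\ y = 1) \/ (x = 1 /\ y = 0) -> \det (row' u (col' v A)) <> 0 ->
  (char_poly_diff (ext_mx A u v x y) (ext_mx 0 u v (1 - x) (1 - y)))`_0 != 0.
Proof.
move=> xy /eqP dA; rewrite !char_poly_diff_coef1 !map_ext_mx scale_ext_mx add_ext_mx.
rewrite map_mx0 scaler0 addr0 coef_map char_poly_det.
have [b ->] := det_ext_mx (map_mx polyC A) u v
  (x%:P + 'X * (1 - x)%:P) (y%:P + 'X * (1 - y)%:P).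
have -> : (x%:P + 'X * (1 - x)%:P) * (y%:P + 'X * (1 - y)%:P) = 'X.
  by case: xy => [[-> ->]|[-> ->]]; rewrite ?subr0 ?subrr polyC0 polyC1; ring.
rewrite -map_col' -map_row' det_map_mx mulrA -exprD.
rewrite -signr_odd; case: odd; rewrite ?expr1 ?expr0 ?mulN1r ?mul1r /=.
  by rewrite coefN coefXM coefC oppr_eq0.
by rewrite coefXM coefC.
Qed.

Lemma char_poly_diff_ext_mx_span :
  (x = 0 /\ y = 1) \/ (x = 1 /\ y = 0) -> \det (row' u (col' v A)) <> 0 ->
  full_rank_jacobian A -> forall q : {poly F}, (size q <= n.+1)%N ->
  exists (H : 'M[F]_n) (s : F), (forall i j, A i j = 0 -> H i j = 0) /\
    char_poly_diff (ext_mx A u v x y)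
      (ext_mx H u v (s * (1 - x)) (s * (1 - y))) = q.
Proof.
move=> xy dA frA q sq.
set B := ext_mx A u v x y.
set d := char_poly_diff B (ext_mx 0 u v (1 - x) (1 - y)).
(* A multiple of [d] corrects the constant coefficient; the rest is 'X times a polynomial of degree
   < n, reached from the old block. *)
have d0 : d`_0 != 0 by exact: char_poly_diff_ext_mx_coef0.
pose s := q`_0 / d`_0; pose q' := q - s *: d.
have q'0 : q'`_0 = 0 by rewrite coefB coefZ divfK // subrr.
have sq' : (size q' <= n.+1)%N.
  rewrite (leq_trans (size_polyD _ _)) // geq_max sq size_polyN.
  by rewrite (leq_trans (size_scale_leq _ _)) // size_char_poly_diff.
have q'E : q' = 'X * (\poly_(i < n) q'`_i.+1).
  apply/polyP=> -[|i]; rewrite coefXM //= coef_poly.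
  by case: ltnP => // ni; rewrite nth_default // (leq_trans sq').
have [H HA HE] := char_poly_diff_span frA (size_poly n (fun i => q'`_i.+1)).
exists H, s; split=> //.
have -> : ext_mx H u v (s * (1 - x)) (s * (1 - y)) =
   ext_mx H u v 0 0 + s *: ext_mx 0 u v (1 - x) (1 - y).
  by rewrite scale_ext_mx add_ext_mx scaler0 !add0r addr0.
rewrite linearD linearZ /= -/d char_poly_diff_ext_mx ?HE -?q'E.
  by rewrite subrK.
by case: xy => -[-> ->]; [left|right].
Qed.
End ExtSpan.

(** * Strict differentiability *)

Section MPolyStrict.
Import mpoly.

(** Adding one factor 'X_k at a time suits the two estimates below, which are easy for constants,
    sums and such products. *)
Lemma mpoly_mulX_ind (R : comNzRingType) m (P : {mpoly R[m]} -> Prop) :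
  (forall c, P c%:MP) -> (forall p q, P p -> P q -> P (p + q)) ->
  (forall p k, P p -> P (p * 'X_k)) -> forall p, P p.
Proof.
move=> PC PD PX; elim/mpolyind => [|c e p _ _ Pp]; first by rewrite -mpolyC0.
apply: PD => //; rewrite -mul_mpolyC mpolyXE_id.
move: (PC c); elim/big_rec: _ (c%:MP) => [q|i y _ IH q] Pq; first by rewrite mulr1.
rewrite mulrA; apply: IH; elim: (e i) => [|d IH]; first by rewrite expr0 mulr1.
by rewrite exprSr mulrA; apply: PX.
Qed.

Variables (R : realFieldType) (m : nat).
Implicit Types (p : {mpoly R[m]}) (x : 'I_m -> R).

Lemma mpoly_lipschitz p : exists2 C, 0 <= C & forall x x' s, 0 <= s ->
  (forall k, `|x k| <= 1) -> (forall k, `|x' k| <= 1) ->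
  (forall k, `|x k - x' k| <= s) -> `|p.@[x] - p.@[x']| <= C * s.
Proof.
elim/mpoly_mulX_ind: p => [c|p q [C C0 Cp] [D D0 Dq]|p k [C C0 Cp]].
- by exists 0 => // *; rewrite !mevalC subrr normr0 mul0r.
- exists (C + D) => [|x x' s s0 x1 x'1 xs]; first exact: addr_ge0.
  rewrite !mevalD opprD addrACA mulrDl (le_trans (ler_normD _ _)) // lerD //.
    exact: Cp.
  exact: Dq.
exists (C + (`|p.@[fun=> 0]| + C)) => [|x x' s s0 x1 x'1 xs].
  by rewrite !addr_ge0.
rewrite !mevalM !mevalXU.
have -> : p.@[x] * x k - p.@[x'] * x' k =
    (p.@[x] - p.@[x']) * x k + p.@[x'] * (x k - x' k) by ring.
rewrite [leRHS]mulrDl (le_trans (ler_normD _ _)) // lerD // normrM.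
  rewrite -[C * s]mulr1; apply: ler_pM => //; exact: Cp.
apply: ler_pM => //.
(* Comparison with the origin bounds p(x') by |p(0)| + C on the unit box. *)
have := Cp x' (fun=> 0) 1 ler01 x'1; rewrite mulr1 normr0 => Cx.
rewrite -[p.@[x']](subrK p.@[fun=> 0]) addrC (le_trans (ler_normD _ _)) // lerD2l.
by apply: Cx => *; rewrite ?subr0 // normr0 ler01.
Qed.

(** On the box of radius r, the remainder of the linear approximation at 0 is Lipschitz with
    constant C r. This smallness is what later yields a contraction. For a product by a variable,
    the Lipschitz bound on [p] suffices. *)
Lemma mpoly_strict_diff p : exists2 C, 0 <= C & forall x x' r s,
  0 <= r -> r <= 1 -> 0 <= s ->
  (forall k, `|x k| <= r) -> (forall k, `|x' k| <= r) ->
  (forall k, `|x k - x' k| <= s) ->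
  `|p.@[x] - p.@[x'] - \sum_k mderiv_at (fun=> 0) k p * (x k - x' k)|
    <= C * (r * s).
Proof.
elim/mpoly_mulX_ind: p => [c|p q [C C0 Cp] [D D0 Dq]|p k _].
- exists 0 => // *; rewrite !mevalC subrr sub0r normrN big1 ?normr0 ?mul0r //.
  by move=> k _; rewrite mderiv_atC mul0r.
- exists (C + D) => [|x x' r s r0 r1 s0 xr x'r xs]; first exact: addr_ge0.
  have -> : \sum_k mderiv_at (fun=> 0) k (p + q) * (x k - x' k) =
      \sum_k mderiv_at (fun=> 0) k p * (x k - x' k) +
      \sum_k mderiv_at (fun=> 0) k q * (x k - x' k).
    by rewrite -big_split; apply: eq_bigr => k _; rewrite raddfD mulrDl.
  rewrite !mevalD.
  rewrite [X in `|X|](_ : _ =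
    (p.@[x] - p.@[x'] - \sum_k mderiv_at (fun=> 0) k p * (x k - x' k)) +
    (q.@[x] - q.@[x'] - \sum_k mderiv_at (fun=> 0) k q * (x k - x' k))).
    by rewrite mulrDl (le_trans (ler_normD _ _)) // lerD //; [exact: Cp|exact: Dq].
  ring.
have [C C0 Cp] := mpoly_lipschitz p.
exists (C + C) => [|x x' r s r0 r1 s0 xr x'r xs]; first exact: addr_ge0.
have -> : \sum_j mderiv_at (fun=> 0) j (p * 'X_k) * (x j - x' j) =
    p.@[fun=> 0] * (x k - x' k).
  have E j : mderiv_at (fun=> 0) j (p * 'X_k) = p.@[fun=> 0] * (j == k)%:R.
    by rewrite point_derivation_mderiv_at mevalXU mulr0 add0r mderiv_atX eq_sym.
  rewrite (bigD1 k) //= big1 ?addr0 => [|j /negPf jk]; rewrite E ?eqxx ?mulr1 //.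
  by rewrite jk mulr0 mul0r.
rewrite !mevalM !mevalXU.
have -> : p.@[x] * x k - p.@[x'] * x' k - p.@[fun=> 0] * (x k - x' k) =
  (p.@[x] - p.@[x']) * x k + (p.@[x'] - p.@[fun=> 0]) * (x k - x' k) by ring.
have x1 j : `|x j| <= 1 by exact: le_trans (xr j) r1.
have x'1 j : `|x' j| <= 1 by exact: le_trans (x'r j) r1.
rewrite [leRHS]mulrDl (le_trans (ler_normD _ _)) // lerD // normrM.
  by rewrite (mulrC r) mulrA ler_pM //; apply: Cp.
rewrite mulrA ler_pM //; apply: Cp => // j; rewrite ?normr0 ?ler01 ?subr0 //.
Qed.

End MPolyStrict.

Section CharPolyStrict.
Import mpoly.
Variables (R : realFieldType) (N : nat) (B : 'M[R]_N).

(** The generic perturbation of [B], with one variable per entry, so that [B] sits at the origin. *)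
Let X : 'M[{mpoly R[N * N]}]_N :=
  \matrix_(i, j) ((B i j)%:MP + 'X_(mxvec_index i j)).

Let evX (H : 'M[R]_N) : map_mx (meval (mxvec H 0)) X = B + H.
Proof. by apply/matrixP=> i j; rewrite !mxE mevalD mevalC mevalXU mxvecE. Qed.

Let mderiv_at0X k : map_mx (mderiv_at (fun=> 0) k) X = vec_mx (delta_mx 0 k).
Proof.
by apply/matrixP=> i j; rewrite !mxE raddfD /= mderiv_atC add0r mderiv_atX.
Qed.

Let mderiv_at0_char_poly k l :
  mderiv_at (fun=> 0) k (char_poly X)`_l =
  (char_poly_diff B (vec_mx (delta_mx 0 k)))`_l.
Proof.
have := point_derivation_char_poly X (point_derivation_mderiv_at (fun=> 0) k).
rewrite mderiv_at0X.
have -> : map_mx (meval (fun=> 0)) X = B.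
  by apply/matrixP=> i j; rewrite !mxE mevalD mevalC mevalXU addr0.
by move<-; rewrite coef_map.
Qed.

Lemma char_poly_coef_strict_diff l :
  exists2 C, 0 <= C & forall (H H' : 'M[R]_N) r s,
  0 <= r -> r <= 1 -> 0 <= s ->
  (forall i j, `|H i j| <= r) -> (forall i j, `|H' i j| <= r) ->
  (forall i j, `|H i j - H' i j| <= s) ->
  `|(char_poly (B + H))`_l - (char_poly (B + H'))`_l
    - (char_poly_diff B (H - H'))`_l| <= C * (r * s).
Proof.
have [C C0 HC] := mpoly_strict_diff (char_poly X)`_l.
exists C => // H H' r s r0 r1 s0 Hr H'r Hs.
rewrite -!evX -!map_char_poly !coef_map /=.
have -> : (char_poly_diff B (H - H'))`_l =
    \sum_k mderiv_at (fun=> 0) k (char_poly X)`_l * (mxvec H 0 k - mxvec H' 0 k).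
  rewrite -[H - H' in LHS]mxvecK [mxvec _ in LHS]row_sum_delta !linear_sum coef_sum.
  apply: eq_bigr => k _.
  by rewrite !linearZ coefZ linearB !mxE mulrC mderiv_at0_char_poly.
apply: HC => // k; case/mxvec_indexP: k => i j; rewrite ?mxvecE //.
Qed.

Lemma char_poly_strict_diff :
  exists2 C, 0 <= C & forall (l : 'I_N) (H H' : 'M[R]_N) r s,
  0 <= r -> r <= 1 -> 0 <= s ->
  (forall i j, `|H i j| <= r) -> (forall i j, `|H' i j| <= r) ->
  (forall i j, `|H i j - H' i j| <= s) ->
  `|(char_poly (B + H))`_l - (char_poly (B + H'))`_l
    - (char_poly_diff B (H - H'))`_l| <= C * (r * s).
Proof.
have /fin_all_exists2[C C0 HC] := fun l : 'I_N => char_poly_coef_strict_diff l.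
exists (\sum_l C l) => [|l H H' r s r0 r1 s0 Hr H'r Hs]; first exact: sumr_ge0.
apply: le_trans (HC l H H' r s r0 r1 s0 Hr H'r Hs) _.
rewrite ler_wpM2r ?mulr_ge0 // (bigD1 l) //= lerDl.
by apply: sumr_ge0.
Qed.
End CharPolyStrict.

From mathcomp Require Import all_classical all_analysis.
Import numFieldNormedType.Exports.

(** * Local surjectivity *)

(** Combines completeness with the norm on matrices, for [banach_fixed_point]. *)
HB.instance Definition _ (R : realType) m n := Complete.on 'M[R]_(m, n).

Lemma rV_norm_leP (R : realType) N (y : 'rV[R]_N) d : 0 <= d ->
  `|y| <= d <-> forall j, `|y 0 j| <= d.
Proof.
move=> d0; rewrite {1}/Num.norm /= mx_normrE; split.
  by move/bigmax_leP => [_ yd] j; apply: (yd (0, j)).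
by move=> yd; apply/bigmax_leP; split=> // -[i j] _ /=; rewrite ord1.
Qed.

(** Banach's theorem on the closed ball of radius d in the maximum norm: G moves 0 by at most d/2
    and halves distances, so it preserves this ball. *)
Lemma half_contraction_fixpoint (R : realType) N (G : 'rV[R]_N -> 'rV[R]_N) (d : R) :
  0 <= d ->
  (forall (y y' : 'rV[R]_N) s, 0 <= s -> (forall j, `|y 0 j| <= d) ->
    (forall j, `|y' 0 j| <= d) -> (forall j, `|y 0 j - y' 0 j| <= s) ->
    forall l, `|G y 0 l - G y' 0 l| <= s / 2) ->
  (forall l, `|G 0 0 l| <= d / 2) ->
  exists2 y : 'rV[R]_N, (forall j, `|y 0 j| <= d) & G y = y.
Proof.
move=> d0 Glip G0.
pose U : set 'rV[R]_N := closed_ball_ Num.norm 0 d.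
have UP y : U y <-> forall j, `|y 0 j| <= d.
  by rewrite /U /closed_ball_ /= sub0r normrN rV_norm_leP.
have GU : {homo G : y / U y >-> U y}%classic.
  move=> y /UP yd; apply/UP => l.
  have := Glip y 0 d d0 yd; rewrite -[G y 0 l](subrK (G 0 0 l)).
  move=> /(_ _ _ l) Gl; rewrite (le_trans (ler_normD _ _)) // [leRHS]splitr.
  by apply: lerD => //; apply: Gl => j; rewrite !mxE ?normr0 ?subr0.
have half0 : 0 <= 2^-1 :> R by rewrite invr_ge0.
have ctr : is_contraction (mkfun GU : {fun U >-> U}).
  exists (NngNum half0); split; first by rewrite /= invf_lt1 ?ltr1n.
  move=> [y y'] [/UP /= yd /UP /= y'd].
  apply/rV_norm_leP; first by rewrite mulr_ge0.
  move=> l; rewrite !mxE mulrC; apply: Glip => // j.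
  have /rV_norm_leP : `|y - y'| <= `|y - y'| by [].
  by move=> /(_ (normr_ge0 _) j); rewrite !mxE.
have [||y /UP yd yG] := banach_fixed_point ctr.
- exact: closed_closed_ball_.
- by exists 0; apply/UP => j; rewrite mxE normr0.
- by exists y.
Qed.

Section LocalSurjectivity.
Variables (R : realType) (N : nat) (B E : 'M[R]_N) (K : 'I_N -> 'M[R]_N).
Hypotheses (charB : char_poly B = 'X^N)
  (diffK : forall j, char_poly_diff B (K j) = 'X^j).

Let H e (y : 'rV[R]_N) := e *: E + \sum_j y 0 j *: K j.
Let kap : R := 1 + \sum_i \sum_k (`|E i k| + \sum_j `|K j i k|).

Let kap1 : 1 <= kap.
Proof.
rewrite lerDl; do 2![apply: sumr_ge0 => ? _].
by rewrite addr_ge0 // sumr_ge0.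
Qed.

Let kap_bound i k : `|E i k| + \sum_j `|K j i k| <= kap.
Proof.
have ge0 i' k' : 0 <= `|E i' k'| + \sum_j `|K j i' k'|.
  by rewrite addr_ge0 // sumr_ge0.
rewrite /kap [in leRHS](bigD1 i) //= [in leRHS](bigD1 k) //=.
have le (a b c : R) : 0 <= b -> 0 <= c -> a <= 1 + (a + b + c) by lra.
by apply: le; apply: sumr_ge0 => // ? _; apply: sumr_ge0.
Qed.

Let H_bound (e : R) (y : 'rV[R]_N) (d : R) : `|e| <= d -> (forall j, `|y 0 j| <= d) ->
  forall i k, `|H e y i k| <= kap * d.
Proof.
move=> ed yd i k; have d0 : 0 <= d by apply: le_trans ed.
apply: le_trans (ler_wpM2r d0 (kap_bound i k)); rewrite mulrDl.
rewrite !mxE (le_trans (ler_normD _ _)) // lerD //.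
  by rewrite normrM mulrC ler_wpM2l.
rewrite summxE (le_trans (ler_norm_sum _ _ _)) // mulr_suml ler_sum // => j _.
by rewrite mxE normrM mulrC ler_wpM2l.
Qed.

Let H_sub e y y' : H e y - H e y' = H 0 (y - y').
Proof.
rewrite /H scale0r add0r opprD addrACA subrr add0r -sumrB.
by apply: eq_bigr => j _; rewrite !mxE scalerBl.
Qed.

Let diffH (y : 'rV_N) (l : 'I_N) : (char_poly_diff B (H 0 y))`_l = y 0 l.
Proof.
rewrite /H scale0r add0r linear_sum coef_sum (bigD1 l) //= big1 ?addr0.
  by rewrite linearZ /= diffK coefZ coefXn eqxx mulr1.
move=> j jl; rewrite linearZ /= diffK coefZ coefXn.
by rewrite [(l == j :> nat)%N]eq_sym (inj_eq val_inj) (negPf jl) mulr0.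
Qed.

(** In the coordinates y, the coefficient map has the identity as differential at 0, so y minus the
    coefficients is a contraction near 0. A fixed point of that map plus c solves the equation. *)
Lemma char_poly_local_surjective d0 : 0 < d0 ->
  exists2 eta, 0 < eta & forall e (c : 'I_N -> R), `|e| <= eta ->
    (forall l, `|c l| <= eta) ->
  exists2 y : 'rV[R]_N, (forall j, `|y 0 j| <= d0) &
    forall l : 'I_N, (char_poly (B + (e *: E + \sum_j y 0 j *: K j)))`_l = c l.
Proof.
move=> d0_gt0; have [C C0 HC] := char_poly_strict_diff B.
have kap0 : 0 < kap by apply: lt_le_trans kap1.
(* The bound d <= 1/Z yields both kap d <= 1, as the strict estimate requires, and C kap^2 d <= 1/2,
   the contraction constant. *)
pose Z := kap + 2 * C * kap ^+ 2.
have CK0 : 0 <= 2 * C * kap ^+ 2 by rewrite !mulr_ge0 // ltW.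
have Z0 : 0 < Z by rewrite /Z; lra.
pose d := Num.min d0 Z^-1.
have d_gt0 : 0 < d by rewrite lt_min d0_gt0 invr_gt0.
have dd0 : d <= d0 by rewrite ge_min lexx.
have dZ : d * Z <= 1 by rewrite -ler_pdivlMr // mul1r ge_min lexx orbT.
have dk : kap * d <= 1.
  by apply: le_trans dZ; rewrite mulrC ler_pM2l // /Z; lra.
have dC : C * kap ^+ 2 * d <= 1 / 2.
  have : (2 * C * kap ^+ 2) * d <= 1.
    by apply: le_trans dZ; rewrite mulrC ler_pM2l // /Z; lra.
  lra.
pose L := \sum_(l < N) `|(char_poly_diff B E)`_l|.
have L0 : 0 <= L by apply: sumr_ge0.
have LE (l : 'I_N) : `|(char_poly_diff B E)`_l| <= L.
  by rewrite /L (bigD1 l) //= lerDl sumr_ge0.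
(* At y = 0 the remainder contributes at most eta/2, the linear effect of [e *: E] at most eta L,
   and c at most eta; the total is below eta (2 + L) = d/2. *)
pose eta := d / (2 * (2 + L)).
have eta_gt0 : 0 < eta by rewrite divr_gt0 // mulr_gt0 //; lra.
have etaE : eta * (2 + L) = d / 2.
  by rewrite /eta; field; apply/eqP; lra.
have eta_d : eta <= d.
  have : 0 <= eta * L by rewrite mulr_ge0 // ltW.
  lra.
exists eta => // e c ee ce.
have ed : `|e| <= d by apply: le_trans eta_d.
pose G (y : 'rV[R]_N) : 'rV[R]_N :=
  \row_l (y 0 l - (char_poly (B + H e y))`_l + c l).
have [|||y yd yG] := @half_contraction_fixpoint R N G d.
- exact: ltW.
- move=> y y' s s0 yd y'd ys l; rewrite !mxE.
  have /(_ l) := HC _ (H e y) (H e y') (kap * d) (kap * s).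
  rewrite H_sub diffH !mxE => HCl.
  rewrite [X in `|X|](_ : _ = - ((char_poly (B + H e y))`_l -
    (char_poly (B + H e y'))`_l - (y 0 l - y' 0 l))); last by ring.
  rewrite normrN; apply: le_trans (HCl _ _ _ _ _ _) _ => //.
  + by rewrite mulr_ge0 // ltW.
  + by rewrite mulr_ge0 // ltW.
  + exact: H_bound.
  + exact: H_bound.
  + move=> i j; have -> : H e y i j - H e y' i j = H 0 (y - y') i j.
      by rewrite -(H_sub e) !mxE.
    by apply: H_bound; rewrite ?normr0 // => k; rewrite !mxE.
  + have -> : C * (kap * d * (kap * s)) = (C * kap ^+ 2 * d) * s by ring.
    by rewrite [s / 2]mulrC ler_wpM2r //; lra.
- move=> l; rewrite !mxE sub0r.
  have H0 : H e 0 = e *: E.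
    by rewrite /H big1 ?addr0 // => j _; rewrite mxE scale0r.
  have ke1 : kap * eta <= 1.
    by apply: le_trans dk; rewrite ler_pM2l.
  have bnd i j : `|(e *: E) i j| <= kap * eta.
    by rewrite -H0; apply: H_bound => // k; rewrite mxE normr0 ltW.
  (* Compare with the zero perturbation: [B] has characteristic polynomial 'X^N, whose coefficients
     below N vanish. *)
  have /(_ l) := HC _ (e *: E) 0 (kap * eta) (kap * eta).
  rewrite H0 subr0 addr0 charB coefXn (ltn_eqF (ltn_ord l)) subr0.
  rewrite linearZ /= coefZ => HCl.
  set f := (char_poly _)`_l in HCl *; set g := (char_poly_diff B E)`_l in HCl.
  have g1 : `|e * g| <= eta * L by rewrite normrM ler_pM // LE.
  have f1 : `|f - e * g| <= eta / 2.
    apply: le_trans (HCl _ _ _ _ _ _) _ => //.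
    + by rewrite mulr_ge0 // ltW.
    + by rewrite mulr_ge0 // ltW.
    + by move=> i j; rewrite mxE normr0 mulr_ge0 // ltW.
    + move=> i j; have -> : (0 : 'M[R]_N) i j = 0 by rewrite mxE.
      by rewrite subr0.
    + have -> : C * (kap * eta * (kap * eta)) = (C * kap ^+ 2 * eta) * eta by ring.
      rewrite [eta / 2]mulrC ler_pM2r //.
      apply: (@le_trans _ _ (C * kap ^+ 2 * d)); last by lra.
      by rewrite ler_wpM2l // mulr_ge0 // exprn_ge0 // ltW.
  rewrite -etaE mulrDr.
  have -> : - f + c l = - (f - e * g) + (- (e * g) + c l) by ring.
  rewrite (le_trans (ler_normD _ _)) // normrN.
  have : `|- (e * g) + c l| <= eta * L + eta.
    by rewrite (le_trans (ler_normD _ _)) // normrN lerD // ce.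
  lra.
exists y => [j|l]; first exact: le_trans (yd j) dd0.
have := congr1 (fun z : 'rV[R]_N => z 0 l) yG; rewrite !mxE -/(H e y).
lra.
Qed.
End LocalSurjectivity.

(** * Spectrally arbitrary patterns *)

(** Substituting tz for z gives det(tzI - tM) = t^N det(zI - M); compare coefficients and cancel
    t^i. *)
Lemma char_poly_scale (F : fieldType) N (t : F) (M : 'M[F]_N) i :
  t != 0 -> (i <= N)%N ->
  (char_poly (t *: M))`_i = t ^+ (N - i) * (char_poly M)`_i.
Proof.
move=> t0 iN.
have E : char_poly (t *: M) \Po (t *: 'X) = t ^+ N *: char_poly M.
  rewrite /char_poly -det_map_mx -[RHS]mul_polyC polyC_exp -detZ; congr (\det _).
  apply/matrixP=> k l; rewrite !mxE /= rmorphB rmorphMn /= comp_polyX comp_polyC.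
  by rewrite -mul_polyC mulrBr polyCM mulrnAr.
have := congr1 (fun p : {poly F} => p`_i) E; rewrite coefZ.
have -> : t ^+ N = t ^+ (N - i) * t ^+ i by rewrite -exprD subnK.
rewrite mulrAC.
rewrite comp_polyE coef_sum.
have -> : \sum_(j < size (char_poly (t *: M)))
    ((char_poly (t *: M))`_j *: (t *: 'X) ^+ j)`_i =
    (char_poly (t *: M))`_i * t ^+ i.
  have iS : (i < size (char_poly (t *: M)))%N by rewrite size_char_poly.
  rewrite (bigD1 (Ordinal iS)) //= big1 ?addr0.
    by rewrite coefZ exprZn coefZ coefXn eqxx mulr1.
  move=> j ji; rewrite coefZ exprZn coefZ coefXn.
  rewrite (_ : (i == j :> nat) = false) ?mulr0 //.
  by apply/negbTE; rewrite eq_sym.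
by apply: mulIf; rewrite expf_neq0.
Qed.

(** The inverse of 1 plus the sum of the inverses works; the 1 also covers an empty index type. *)
Lemma exists_pos_lower_bound (R : realFieldType) (I : finType) (a : I -> R) :
  (forall i, 0 < a i) -> exists2 d, 0 < d & forall i, d <= a i.
Proof.
move=> a0; have ge0 i : 0 <= (a i)^-1 by rewrite invr_ge0 ltW.
have S0 : 0 < 1 + \sum_i (a i)^-1 by rewrite ltr_pwDl // sumr_ge0.
exists (1 + \sum_i (a i)^-1)^-1 => [|i]; first by rewrite invr_gt0.
rewrite -[a i]invrK lef_pV2 ?posrE ?invr_gt0 //.
rewrite (bigD1 i) //= addrCA lerDl addr_ge0 // sumr_ge0 //.
Qed.

Lemma perturbation_neq0 (R : realFieldType) (N m : nat) (B : 'M[R]_N)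
    (K : 'I_m -> 'M[R]_N) :
  exists2 d, 0 < d & forall y : 'rV[R]_m, (forall l, `|y 0 l| <= d) ->
    forall i j, B i j != 0 -> B i j + \sum_l y 0 l * K l i j != 0.
Proof.
pose k (ij : 'I_N * 'I_N) := \sum_l `|K l ij.1 ij.2|.
have k0 ij : 0 <= k ij by apply: sumr_ge0.
have k1 ij : 0 < 1 + k ij by rewrite ltr_pwDl.
(* The value 1 at zero entries is a positive placeholder. Elsewhere d (1 + k) <= |B_ij| makes the
   perturbation, at most d k, smaller than the entry. *)
pose a ij := if B ij.1 ij.2 == 0 then 1 else `|B ij.1 ij.2| / (1 + k ij).
have [|d d0 dle] := @exists_pos_lower_bound R _ a.
  by move=> ij; rewrite /a; case: eqP => // /eqP B0; rewrite divr_gt0 // normr_gt0.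
exists d => // y yd i j Bij.
have := dle (i, j); rewrite /a /= (negPf Bij) ler_pdivlMr // => dB.
apply/eqP => /eqP; rewrite addr_eq0 => /eqP BE.
have : `|B i j| <= d * k (i, j).
  rewrite BE normrN (le_trans (ler_norm_sum _ _ _)) // mulr_sumr ler_sum // => l _.
  by rewrite normrM ler_pM.
rewrite mulrDr mulr1 in dB; lra.
Qed.

(** Shrinking the roots of p by a small t brings its coefficients into the locally attained range;
    dividing the matrix found by t restores p and keeps the pattern. *)
Lemma spectrally_arbitrary_of_nilpotent (R : realType) N (P : pattern N)
    (B E : 'M[R]_N) (K : 'I_N -> 'M[R]_N) :
  char_poly B = 'X^N -> (forall j, char_poly_diff B (K j) = 'X^j) ->
  (exists2 d0, 0 < d0 & forall e (y : 'rV[R]_N), e != 0 ->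
     (forall j, `|y 0 j| <= d0) ->
     has_pattern P (B + (e *: E + \sum_j y 0 j *: K j))) ->
  spectrally_arbitrary R P.
Proof.
move=> charB diffK [d0 d0_gt0 HP] p mp sp.
have [eta eta0 Hsurj] := char_poly_local_surjective E charB diffK d0_gt0.
pose S := \sum_(l < N) `|p`_l|.
have S0 : 0 <= S by apply: sumr_ge0.
have S1 : 0 < 1 + S by rewrite ltr_pwDl.
(* As t <= 1 and l < N, t^(N - l) <= t, so every scaled coefficient is at most t S, hence at most
   eta. *)
pose t := Num.min 1 (eta / (1 + S)).
have t0 : 0 < t by rewrite lt_min ltr01 divr_gt0.
have t1 : t <= 1 by rewrite ge_min lexx.
have tS : t * (1 + S) <= eta by rewrite -ler_pdivlMr // ge_min lexx orbT.
(* The parameter e is taken to be [eta] itself, which is nonzero. *)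
have [||y yd yE] := Hsurj eta (fun l => t ^+ (N - l) * p`_l).
- by rewrite gtr0_norm.
- move=> l; apply: le_trans tS.
  have t0' := ltW t0; rewrite normrM ger0_norm ?exprn_ge0 // ler_pM ?exprn_ge0 //.
    by rewrite -[leRHS]expr1 ler_wiXn2l // subn_gt0.
  rewrite ltW // (@le_lt_trans _ _ S) //; last by rewrite ltrDr ltr01.
  by rewrite /S (bigD1 l) //= lerDl sumr_ge0.
set M := B + _ in yE.
exists (t^-1 *: M).
  have := HP eta y (lt0r_neq0 eta0) yd; rewrite -/M => PM i j.
  have -> : (t^-1 *: M) i j = t^-1 * M i j by rewrite mxE.
  have := PM i j; case: (P i j) => //.
    by move=> ->; rewrite mulr0.
  by move/eqP => Mij; apply/eqP; rewrite mulf_neq0 // invr_eq0 gt_eqF.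
apply/polyP => l; have sM := size_char_poly (t^-1 *: M).
case: (ltngtP l N) => lN.
- rewrite char_poly_scale ?invr_eq0 ?gt_eqF //; last exact: ltnW.
  by rewrite (yE (Ordinal lN)) /= exprVn mulKf // expf_neq0 // gt_eqF.
- by rewrite !nth_default ?sM ?sp.
- have /monicP := char_poly_monic (t^-1 *: M); have /monicP := mp.
  by rewrite !lead_coefE sM sp lN /= => -> ->.
Qed.

Theorem theorem5p1 (R : realType) (n : nat) (PA : pattern n) (A : 'M[R]_n)
    (u v : 'I_n) (PB : pattern n.+1) :
  has_pattern PA A ->
  nilpotent_mx A ->
  full_rank_jacobian A ->
  u <> v ->
  \det (row' u (col' v A)) <> 0 ->
  circledast_extension PA u v PB ->
  forall PC : pattern n.+1, superpattern PB PC -> spectrally_arbitrary R PC.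
Proof.
move=> patA nilA frA _ detA [Hoo Hww How Hwo [nu nv free]] PC sup.
(* The new entry known to be free is set to 0, the other to 1. *)
have [x [y [xy x0 y0]]] : exists x y : R,
  [/\ (x = 0 /\ y = 1) \/ (x = 1 /\ y = 0),
      PB (lift ord_max u) ord_max = Star -> x <> 0 &
      PB ord_max (lift ord_max v) = Star -> y <> 0].
  have one0 : 1 <> 0 :> R by apply/eqP; rewrite oner_eq0.
  by case: free => ->; [exists 0, 1|exists 1, 0]; split=> //; [left|right].
set B := ext_mx A u v x y.
have /fin_all_exists[H0 /fin_all_exists[s HK]] : forall j : 'I_n.+1,
    exists (H : 'M[R]_n) (s : R), (forall i j, A i j = 0 -> H i j = 0) /\
    char_poly_diff B (ext_mx H u v (s * (1 - x)) (s * (1 - y))) = 'X^j.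
  move=> j; apply: char_poly_diff_ext_mx_span => //.
  by rewrite size_polyXn.
pose K j := ext_mx (H0 j) u v (s j * (1 - x)) (s j * (1 - y)).
(* Only the extra positions labeled [Star] need a nonzero value; extra [Free] positions may stay
   0. *)
pose E : 'M[R]_n.+1 := \matrix_(i, j)
  match PB i j, PC i j with Zero, Star => 1 | _, _ => 0 end.
have supp i j : match PB i j with
                | Zero => B i j = 0 /\ forall l, K l i j = 0
                | Star => B i j <> 0
                | Free => True
                end.
  case: (unliftP ord_max i) => [i' ->|->]; case: (unliftP ord_max j) => [j' ->|->].
  - rewrite Hoo /B ext_mx_oo; have := patA i' j'; case: (PA i' j') => // A0.
    by split=> // l; rewrite /K ext_mx_oo; have [-> //] := HK l.
  - rewrite /B ext_mx_ow; case: (i' =P u) => [->|iu].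
      by case: (PB _ _) nu x0 => // _; apply.
    by rewrite How //; split=> // l; rewrite /K ext_mx_ow; case: eqP.
  - rewrite /B ext_mx_wo; case: (j' =P v) => [->|jv].
      by case: (PB _ _) nv y0 => // _; apply.
    by rewrite Hwo //; split=> // l; rewrite /K ext_mx_wo; case: eqP.
  - by rewrite Hww /B ext_mx_ww; split=> // l; rewrite /K ext_mx_ww.
apply: (@spectrally_arbitrary_of_nilpotent R n.+1 PC B E K).
- rewrite char_poly_ext_mx ?(char_poly_nilpotent nilA) ?exprS //.
  by case: xy => -[-> ->]; [left|right].
- by move=> j; case: (HK j).
have [d d0 Hd] := perturbation_neq0 B K.
exists d => // e z e0 zd i j.
have -> : (B + (e *: E + \sum_l z 0 l *: K l)) i j =
    B i j + (e * E i j + \sum_l z 0 l * K l i j).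
  have add (X Y Z : 'M[R]_n.+1) :
      (X + (e *: Y + Z)) i j = X i j + (e * Y i j + Z i j) by rewrite !mxE.
  rewrite add summxE; congr (_ + (_ + _)).
  by apply: eq_bigr => l _; rewrite mxE.
rewrite [E i j]mxE.
have := supp i j; have := sup i j; have := Hd z zd i j.
(* At a [Zero] of [PB] the entry is e times that of [E]; at a [Star] the nonzero entry of [B]
   survives the perturbation; at a [Free] position [PC] is free too. *)
case: (PB i j) => [_ _ [-> K0]|Hz -> // /eqP /Hz /eqP|_ -> //].
  rewrite add0r big1 ?addr0 => [|l _]; last by rewrite K0 mulr0.
  case: (PC i j) => //; rewrite ?mulr0 // mulr1; exact/eqP.
by rewrite mulr0 add0r.
Qed.
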